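(* Let $\Omega\subset\mathbb R^N$ be a bounded and convex domain, let $\mu\in\mathcal P(\Omega\times\{0,1\})$ be a probability measure, and let $\varrho_i:=\mu(\,\cdot\,\times\{i\})$ for $i=0,1$ be absolutely continuous with respect to the Lebesgue measure (with densities again denoted $\varrho_0,\varrho_1$). For all $u\in L^\infty(\Omega)$, $\Psi\in\mathfrak P$ and $i\in\{0,1\}$, $$\int_\Omega\int_\Omega\Psi(x,y)\varrho_i(x)\,\mathrm{grad}_\varepsilon[u](x,y)\,\mathrm dy\,\mathrm dx=-\int_\Omega u(y)\,\mathrm{div}_\varepsilon[\Psi\varrho_i](y)\,\mathrm dy.$$ Moreover, for all $u\in L^\infty(\Omega)$, $$\mathrm{TV}_\varepsilon(u)=\sup_{\boldsymbol\Psi\in\mathfrak P\times\mathfrak P}-\int_\Omega u(y)\,\mathrm{div}_\varepsilon[\boldsymbol\Psi;\boldsymbol\varrho](y)\,\mathrm dy.$$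
   Context: Fix $\varepsilon>0$; $\mathrm B_\varepsilon(x)=\{y\in\mathbb R^N:|x-y|<\varepsilon\}$ with closure $\overline{\mathrm B}_\varepsilon(x)$. All a.e./ess notions are with respect to Lebesgue measure. $$\mathrm{TV}_\varepsilon(u)=\int_\Omega\frac{\operatorname{ess\,sup}_{\mathrm B_\varepsilon(x)\cap\Omega}u-u(x)}{\varepsilon}\varrho_0(x)\,\mathrm dx+\int_\Omega\frac{u(x)-\operatorname{ess\,inf}_{\mathrm B_\varepsilon(x)\cap\Omega}u}{\varepsilon}\varrho_1(x)\,\mathrm dx.$$ $\mathfrak P$ is the set of $\Psi\in L^1(\Omega\times\Omega)$ with $\Psi\ge0$ a.e. on $\Omega\times\Omega$ and (for a representative) $\int_\Omega\Psi(x,y)\,\mathrm dy=1$ and $\operatorname{ess\,supp}\Psi(x,\cdot)\subset\overline{\mathrm B}_\varepsilon(x)\cap\overline\Omega$ for $x\in\Omega$. $\mathrm{grad}_\varepsilon[u](x,y)=\frac{u(y)-u(x)}{\varepsilon}$. For $f\in L^1(\Omega\times\Omega)$, $\mathrm{div}_\varepsilon[f](y)=\int_{\mathrm B_\varepsilon(y)\cap\Omega}\frac{f(y,x)-f(x,y)}{\varepsilon}\,\mathrm dx$. $(\Psi\varrho_i)(x,y):=\Psi(x,y)\varrho_i(x)$. For $\boldsymbol\Psi=(\Psi_0,\Psi_1)$ and $\boldsymbol\varrho=(\varrho_0,\varrho_1)$, $[\boldsymbol\Psi;\boldsymbol\varrho]:=\Psi_0\varrho_0-\Psi_1\varrho_1$,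 and $\mathrm{div}_\varepsilon[\boldsymbol\Psi;\boldsymbol\varrho]$ means $\mathrm{div}_\varepsilon$ applied to this function. *)

(* Defs.v *)
From HB Require Import structures.
From mathcomp Require Import all_boot all_order all_algebra.
From mathcomp Require Import all_classical all_reals all_analysis.
From mathcomp Require Import measurable_realfun ess_sup_inf.

Set Implicit Arguments.
Unset Strict Implicit.
Unset Printing Implicit Defensive.

Import Order.TTheory GRing.Theory Num.Theory.
Import numFieldNormedType.Exports.

Local Open Scope classical_set_scope.
Local Open Scope ring_scope.

(* R^n is 'rV[R]_n with its Borel sigma-algebra. *)
Fact borel_rV_display : measure_display. Proof. by []. Qed.

HB.instance Definition _ (R : realType) (n : nat) :=
  @isMeasurable.Build borel_rV_display 'rV[R]_n <<s open >>
    (@sigma_algebra0 _ setT open) (@sigma_algebraC _ open)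
    (@sigma_algebra_bigcup _ setT open).

Section borel_rV.
Variable R : realType.

Lemma measurable_rVE n : @measurable _ 'rV[R]_n = <<s open >>.
Proof. by []. Qed.

Lemma open_measurable_rV n (A : set 'rV[R]_n) : open A -> measurable A.
Proof. exact: sub_sigma_algebra. Qed.

(* Balls of 'rV[R]_n are those of the sup norm. *)
Lemma open_bigcup_ball n (A : set 'rV[R]_n) : open A ->
  A = \bigcup_(p in [set p : 'rV[rat]_n * nat |
        ball (map_mx ratr p.1 : 'rV[R]_n) p.2.+1%:R^-1 `<=` A])
      ball (map_mx ratr p.1 : 'rV[R]_n) p.2.+1%:R^-1.
Proof.
move=> oA; apply/seteqP; split=> [x Ax|x [p /= pA px]]; last exact: pA.
have /nbhs_ballP[e /= e0 eA] : nbhs x A by exact: open_nbhs_nbhs.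
have [k ke] : exists k : nat, k.+1%:R^-1 < e / 2.
  exists (Num.truncn (e / 2)^-1).
  rewrite invf_plt ?posrE ?divr_gt0//.
  by rewrite truncnS_gt.
have k0 : 0 < k.+1%:R^-1 :> R by rewrite invr_gt0.
have qP i : exists q : rat, ratr q \in `](x 0 i - k.+1%:R^-1), (x 0 i + k.+1%:R^-1)[.
  have [|q Hq] := @rat_in_itvoo R (x 0 i - k.+1%:R^-1) (x 0 i + k.+1%:R^-1).
    by rewrite ltrBlDr -addrA ltrDl addr_gt0.
  by exists q.
have [q Hq] := choice qP.
exists ((\row_i q i), k) => /=; last first.
  split=> // i j; rewrite ord1 !mxE /ball/= distrC ltr_distlC.
  by have := Hq j; rewrite in_itv.
move=> y [_ yB]; apply: eA; split=> // i j.
have := yB i j; rewrite ord1 !mxE /ball/= => yj.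
have := Hq j; rewrite in_itv/= -ltr_distlC => xj.
rewrite (splitr e) -(subrK (ratr (q j)) (x 0 j)) -addrA.
by rewrite (le_lt_trans (ler_normD _ _))// ltrD// (lt_trans _ ke).
Qed.

Lemma continuous_measurable_rV d (T : measurableType d) n
    (f : 'rV[R]_n -> T) (G : set (set T)) :
  @measurable _ T = <<s G >> -> (forall A, G A -> open (f @^-1` A)) ->
  measurable_fun setT f.
Proof.
move=> TG fG; apply: (measurability _ TG) => _ [A GA <-].
by rewrite setTI; apply: open_measurable_rV; exact: fG.
Qed.

Lemma measurable_coord n (i : 'I_n) :
  measurable_fun setT (fun v : 'rV[R]_n => v 0 i).
Proof.
apply: (continuous_measurable_rV (RGenOInfty.measurableE R)) => _ [a ->].
apply: open_comp => [v _|]; last exact: rray_open.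
exact: coord_continuous.
Qed.

Definition rV_cons n (p : R * 'rV[R]_n) : 'rV[R]_n.+1 :=
  row_mx (p.1)%:M p.2 : 'rV_(1 + n).

Definition rV_uncons n (v : 'rV[R]_n.+1) : R * 'rV[R]_n :=
  (v 0 0, rsubmx (v : 'rV_(1 + n))).

Lemma rV_cons0 n (p : R * 'rV[R]_n) : rV_cons p 0 0 = p.1.
Proof.
have := row_mxEl ((p.1)%:M : 'M[R]_(1, 1)) p.2 0 (0 : 'I_1); rewrite [in RHS]mxE eqxx mulr1n => <-.
by congr (row_mx _ _ _ _); exact: val_inj.
Qed.

Lemma rV_consS n (p : R * 'rV[R]_n) (j : 'I_n) :
  rV_cons p 0 (rshift 1 j) = p.2 0 j.
Proof. exact: row_mxEr. Qed.

Lemma rV_consK n : cancel (@rV_cons n) (@rV_uncons n).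
Proof.
move=> [x v]; rewrite /rV_uncons rV_cons0; congr pair.
by apply/rowP => j; rewrite mxE rV_consS.
Qed.

Lemma preimage_rV_cons_ball n (c : 'rV[R]_n.+1) (r : R) : 0 < r ->
  @rV_cons n @^-1` ball c r =
  ball (rV_uncons c).1 r `*` ball (rV_uncons c).2 r.
Proof.
move=> r0; apply/seteqP; split=> -[x v] /=.
  move=> [_ cB]; split; first by have := cB 0 0; rewrite rV_cons0.
  split=> // i j; have := cB i (rshift 1 j).
  by rewrite ord1 rV_consS !mxE.
move=> [cx [_ cv]]; split=> // i j; rewrite ord1.
have [->|j0] := eqVneq j 0; first by rewrite rV_cons0.
have j_gt0 : (0 < j)%N by rewrite lt0n.
have jn : (j.-1 < n)%N by rewrite prednK// -ltnS.
have -> : j = rshift 1 (Ordinal jn) by apply: val_inj; rewrite /= add1n prednK.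
by rewrite rV_consS; have := cv 0 (Ordinal jn); rewrite mxE.
Qed.

Lemma measurable_rV_cons n : measurable_fun setT (@rV_cons n).
Proof.
apply: (measurability _ (measurable_rVE n.+1)) => _ [A oA <-].
rewrite setTI (open_bigcup_ball oA) preimage_bigcup.
rewrite bigcup_mkcond; apply: countable_bigcupT_measurable => // p.
case: ifPn => // _; rewrite preimage_rV_cons_ball ?invr_gt0//.
apply: measurableX; first exact: measurable_ball.
by apply: open_measurable_rV; exact: ball_open.
Qed.

Lemma measurable_rV_uncons n : measurable_fun setT (@rV_uncons n).
Proof.
apply/measurable_fun_pairP; split; first exact: measurable_coord.
apply: (continuous_measurable_rV (measurable_rVE n)) => A oA.
apply: open_comp oA => v _.
move=> B /= /nbhs_ballP[e e0 eB]; apply/nbhs_ballP; exists e => //= w [_ vw].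
by apply: eB; split=> // i j; rewrite !mxE.
Qed.

End borel_rV.

(* [lebesgue_rV] below is the iterated product of the one-dimensional Lebesgue
   measure, transported along R * R^n ~ R^n.+1; [lebesgue_rV_box] checks that a
   box gets the product of the lengths of its sides. *)
Section lebesgue_rV_step.
Local Open Scope ereal_scope.
Variables (R : realType) (n : nat) (m : {sigma_finite_measure set 'rV[R]_n -> \bar R}).

Definition lebesgue_rV_step : set 'rV[R]_n.+1 -> \bar R :=
  pushforward (@lebesgue_measure R \x m) (@rV_cons R n).

Let step0 : lebesgue_rV_step set0 = 0.
Proof. by rewrite /lebesgue_rV_step /pushforward preimage_set0 measure0. Qed.

Let step_ge0 A : 0 <= lebesgue_rV_step A.
Proof. by rewrite /lebesgue_rV_step /pushforward measure_ge0. Qed.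

Let step_sigma_additive : semi_sigma_additive lebesgue_rV_step.
Proof.
move=> F mF tF mUF; rewrite /lebesgue_rV_step /pushforward preimage_bigcup.
have mp A : measurable A -> measurable (@rV_cons R n @^-1` A).
  by move=> mA; rewrite -[X in measurable X]setTI; exact: measurable_rV_cons.
apply: measure_semi_sigma_additive.
- by move=> k; exact: mp.
- apply/trivIsetP => /= i j _ _ ij; rewrite -preimage_setI.
  by move/trivIsetP : tF => /(_ _ _ _ _ ij) ->//; rewrite preimage_set0.
- by rewrite -preimage_bigcup; exact: mp.
Qed.

HB.instance Definition _ := isMeasure.Build _ _ _ lebesgue_rV_step
  step0 step_ge0 step_sigma_additive.

Let lebesgue_rV_step_sigma_finite : sigma_finite setT lebesgue_rV_step.
Proof.
have /sigma_finiteP[F [TF ndF Foo]] := sigma_finiteT (@lebesgue_measure R).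
have /sigma_finiteP[G [TG ndG Goo]] := sigma_finiteT m.
exists (fun k => @rV_uncons R n @^-1` (F k `*` G k)).
  rewrite -preimage_bigcup; apply/esym/seteqP; split=> // v _.
  have [i _ Fi] : (\bigcup_i F i) (rV_uncons v).1 by rewrite -TF.
  have [j _ Gj] : (\bigcup_i G i) (rV_uncons v).2 by rewrite -TG.
  exists (maxn i j) => //; split.
    by move: Fi; exact/subsetPset/ndF/leq_maxl.
  by move: Gj; exact/subsetPset/ndG/leq_maxr.
move=> k; have [mF Fk] := Foo k; have [mG Gk] := Goo k; split.
  rewrite -[X in measurable X]setTI.
  by apply: measurable_rV_uncons => //; exact: measurableX.
rewrite /lebesgue_rV_step /pushforward -comp_preimage.
rewrite (_ : _ \o _ = id) ?preimage_id; last first.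
  by apply/funext => x; exact: rV_consK.
by rewrite product_measure1E// lte_mul_pinfty// ge0_fin_numE.
Qed.

HB.instance Definition _ := Measure_isSigmaFinite.Build _ _ _ lebesgue_rV_step
  lebesgue_rV_step_sigma_finite.

End lebesgue_rV_step.

Section lebesgue_rV.
Local Open Scope ereal_scope.
Variable R : realType.

Fixpoint lebesgue_rV (n : nat) : {sigma_finite_measure set 'rV[R]_n -> \bar R} :=
  match n with
  | 0 => dirac (0%R : 'rV[R]_0)
  | n'.+1 => lebesgue_rV_step (lebesgue_rV n')
  end.

Lemma measurable_box n (A : 'I_n -> set R) : (forall i, measurable (A i)) ->
  measurable [set v : 'rV[R]_n | forall i, A i (v 0%R i)].
Proof.
move=> mA; rewrite [X in measurable X](_ : _ =
    \bigcap_(i in [set: 'I_n]) ((fun v : 'rV[R]_n => v 0%R i) @^-1` A i)).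
  apply: fin_bigcap_measurable; first exact: finite_finset.
  by move=> i _; rewrite -[X in measurable X]setTI; exact: measurable_coord.
by apply/seteqP; split=> v /= Av i; [move=> _|]; exact: Av.
Qed.

Lemma lebesgue_rV_box n (A : 'I_n -> set R) : (forall i, measurable (A i)) ->
  lebesgue_rV n [set v | forall i, A i (v 0%R i)] =
  \prod_(i < n) lebesgue_measure (A i).
Proof.
elim: n A => [|n IH] A mA.
  by rewrite big_ord0 /= diracE mem_set//; case.
have mB := @measurable_box n (fun i => A (lift ord0 i)) (fun i => mA _).
rewrite big_ord_recl -(IH (fun i => A (lift ord0 i)))//.
transitivity ((@lebesgue_measure R \x lebesgue_rV n)
    (A ord0 `*` [set v : 'rV[R]_n | forall i, A (lift ord0 i) (v 0%R i)])); last first.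
  exact (product_measure1E (@lebesgue_measure R) (lebesgue_rV n) (mA ord0) mB).
rewrite /= /lebesgue_rV_step /pushforward; congr ((_ \x _) _).
have lr (j : 'I_n) : lift ord0 j = rshift 1 j by exact: val_inj.
apply/seteqP; split=> -[x v] /=.
  move=> Av; split; first by have := Av ord0; rewrite rV_cons0.
  by move=> j; have := Av (lift ord0 j); rewrite {2}lr rV_consS.
move=> [Ax Av] i; case: (unliftP ord0 i) => [j|] ->; last by rewrite rV_cons0.
by rewrite {2}lr rV_consS; exact: Av.
Qed.

End lebesgue_rV.

Section euclidean.
Variables (R : realType) (N : nat).

(* The library norm on 'rV[R]_N is the sup norm. *)
Definition enorm (v : 'rV[R]_N) : R := Num.sqrt (\sum_(i < N) v 0 i ^+ 2).

Definition eball (x : 'rV[R]_N) (r : R) : set 'rV[R]_N :=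
  [set y | enorm (x - y) < r].

Definition is_domain (Omega : set 'rV[R]_N) : Prop :=
  [/\ Omega !=set0, open Omega & connected Omega].

End euclidean.

Section essential.
Local Open Scope ereal_scope.
Context d (T : measurableType d) (R : realType).
Variable m : {measure set T -> \bar R}.
Implicit Types (D : set T) (u : T -> R).

(* Essential bounds over a set D: [ess_sup] and [ess_inf] of the library for the
   restriction of m to D, see [ess_sup_onE] and [ess_inf_onE]. *)
Definition ess_sup_on D u : \bar R :=
  ereal_inf [set y | {ae m, forall x, D x -> (u x)%:E <= y}].

Definition ess_inf_on D u : \bar R :=
  ereal_sup [set y | {ae m, forall x, D x -> y <= (u x)%:E}].

Lemma ae_mrestrE D (mD : measurable D) (P : T -> Prop) :
  (\forall x \ae mrestr m mD, P x) <-> {ae m, forall x, D x -> P x}.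
Proof.
split=> -[A [mA A0 PA]].
  exists (A `&` D); split=> //; first exact: measurableI.
  move=> x /= /not_implyP[Dx Px]; split=> //; exact: PA.
exists (A `|` ~` D); split.
- by apply: measurableU => //; exact: measurableC.
- rewrite /mrestr setIUl setICl setU0; apply: (subset_measure0 _ mA _ A0) => //.
  exact: measurableI.
- move=> x /= Px; have [Dx|] := pselect (D x); last by right.
  by left; apply: PA => /= /(_ Dx).
Qed.

Lemma ess_sup_onE D (mD : measurable D) u :
  ess_sup_on D u = ess_sup (mrestr m mD) (EFin \o u).
Proof.
by congr ereal_inf; apply/seteqP; split=> y /=; rewrite ae_mrestrE.
Qed.

Lemma ess_inf_onE D (mD : measurable D) u :
  ess_inf_on D u = ess_inf (mrestr m mD) (EFin \o u).
Proof.
by congr ereal_sup; apply/seteqP; split=> y /=; rewrite ae_mrestrE.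
Qed.

(* Representatives of elements of L^oo(D). *)
Definition Linfty D : set (T -> R) :=
  [set u : T -> R | measurable_fun D u /\ ess_sup_on D (fun x => `|u x|%R) < +oo].

End essential.

Section nonlocal.
Local Open Scope ereal_scope.
Variables (R : realType) (N : nat).
Local Notation E := 'rV[R]_N.
Local Notation lam := (lebesgue_rV R N).
Implicit Types (Omega : set E) (eps : R) (u : E -> R) (f Psi : E * E -> R).

Definition ess_supp Omega u : set E :=
  ~` \bigcup_(O in [set O : set E |
        open O /\ {ae lam, forall x, (Omega `&` O) x -> u x = 0%R}]) O.

Definition marginal (mu : set (E * bool) -> \bar R) (i : bool) : set E -> \bar R :=
  fun A => mu (A `*` [set i]).

Definition is_density Omega (nu : set E -> \bar R) (rho : E -> R) : Prop :=
  lam.-integrable Omega (EFin \o rho) /\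
  forall A, measurable A -> A `<=` Omega ->
    nu A = \int[lam]_(x in A) (rho x)%:E.

(* Elements of [admissible] are arbitrary representatives of the classes making
   up the set P of admissible kernels; Psi' is the distinguished one. *)
Definition admissible Omega eps : set (E * E -> R) :=
  [set Psi |
    [/\ (lam \x lam).-integrable (Omega `*` Omega) (EFin \o Psi),
        {ae lam \x lam, forall z, (Omega `*` Omega) z -> (0 <= Psi z)%R} &
        exists Psi' : E * E -> R,
          [/\ measurable_fun (Omega `*` Omega) Psi',
              {ae lam \x lam, forall z, (Omega `*` Omega) z -> Psi' z = Psi z} &
              forall x, Omega x ->
                \int[lam]_(y in Omega) (Psi' (x, y))%:E = 1 /\
                ess_supp Omega (fun y => Psi' (x, y)) `<=`
                  closure (eball x eps) `&` closure Omega]]].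

Definition grad_eps eps u : E * E -> R :=
  fun z => ((u z.2 - u z.1) / eps)%R.

Definition div_eps Omega eps f : E -> \bar R :=
  fun y => \int[lam]_(x in eball y eps `&` Omega)
    ((f (y, x) - f (x, y)) / eps)%:E.

Definition weight Psi (rho : E -> R) : E * E -> R :=
  fun z => (Psi z * rho z.1)%R.

(* Pairs indexed by {0, 1} are indexed by bool, false being 0 and true being 1. *)
Definition weight2 (Psi : bool -> E * E -> R) (rho : bool -> E -> R) : E * E -> R :=
  fun z => (weight (Psi false) (rho false) z - weight (Psi true) (rho true) z)%R.

Definition TV_eps Omega eps (rho : bool -> E -> R) u : \bar R :=
  \int[lam]_(x in Omega)
    ((ess_sup_on lam (eball x eps `&` Omega) u - (u x)%:E) * (eps^-1)%:E
      * (rho false x)%:E) +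
  \int[lam]_(x in Omega)
    (((u x)%:E - ess_inf_on lam (eball x eps `&` Omega) u) * (eps^-1)%:E
      * (rho true x)%:E).

End nonlocal.

(* Main.v *)
(* Since [rho i] depends on the first variable only, Fubini and the swap
   [(x, y) -> (y, x)] turn [- int u div f] into [int int f grad u]; cutting the
   inner integral of [div] down to the open ball is harmless because
   [Psi (x, .)] lives on the closed ball and spheres are null. For the formula
   for TV, [int Psi (x, y) u y dy] is an average of [u] over the ball around [x],
   hence at most the essential supremum [s x] of [u] there; uniform densities on
   the superlevel sets [{y in B(x) | u y > s x - c}], which have positive measure,
   attain it up to [c]. The essential infimum is handled through [- u]. *)
Require Import Defs.
From HB Require Import structures.
From mathcomp Require Import all_boot all_order all_algebra.
From mathcomp Require Import all_classical all_reals all_analysis.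
From mathcomp Require Import measurable_realfun ess_sup_inf.

Set Implicit Arguments.
Unset Strict Implicit.
Unset Printing Implicit Defensive.

Import Order.TTheory GRing.Theory Num.Theory.
Import numFieldNormedType.Exports.

Local Open Scope classical_set_scope.
Local Open Scope ring_scope.
Local Open Scope ereal_scope.

(** * Integration almost everywhere and on products *)

(** Two difficulties shape the argument. An admissible [Psi] is only a class: its sign is known
    almost everywhere on the product, its mass and support only for some other representative. It is
    therefore traded for a kernel [K] that is nonnegative and vanishes off the open strip
    everywhere. As [Psi] and [rho] are both merely integrable, integrability of [weight Psi rho] is
    not automatic; it comes from the unit mass of [K (x, .)], which also gives
    [int int K (x, y) g x = int g]. This identity writes each half of TV as a double integral
    against the very kernel it is compared with, so both bounds become pointwise comparisons on
    [Omega2]. Secondly, essential bounds hold fibre by fibre, off a null set that depends on [x].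
    They become statements almost everywhere on the product by exhibiting a measurable exceptional
    set all of whose sections are null ([ae_of_section]); this in turn requires [sup_ball u] to be
    measurable. *)

Section ae_integration.
Context d (T : measurableType d) (R : realType).
Variables (m : {measure set T -> \bar R}) (D : set T).
Hypothesis mD : measurable D.

Lemma ae_eq_integrable (f g : T -> \bar R) : measurable_fun D g ->
  ae_eq m D f g -> m.-integrable D f -> m.-integrable D g.
Proof.
move=> mg fg /integrableP[mf foo]; apply/integrableP; split => //.
rewrite (@ae_eq_integral _ _ _ m D (fun x => `|f x|))//.
- exact: measurableT_comp.
- exact: measurableT_comp.
- by move: fg; apply: filterS => x /= fg Dx; rewrite fg.
Qed.

Lemma ae_le_integral (f g : T -> \bar R) :
  m.-integrable D f -> m.-integrable D g ->
  {ae m, forall x, D x -> f x <= g x} ->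
  \int[m]_(x in D) f x <= \int[m]_(x in D) g x.
Proof.
move=> fi gi [N [mN N0 fgN]].
rewrite (negligible_integral mN mD fi N0) (negligible_integral mN mD gi N0).
apply: le_integral.
- exact: measurableD.
- by apply: integrableS fi; [| exact: measurableD| exact: subDsetl].
- by apply: integrableS gi; [| exact: measurableD| exact: subDsetl].
- move=> x /[!inE] -[Dx Nx]; apply: contrapT => fg; apply: Nx.
  by apply: fgN => /= /(_ Dx).
Qed.

Lemma integrableM_ae_bounded (f g : T -> R) (M : R) :
  m.-integrable D (EFin \o f) -> measurable_fun D g ->
  {ae m, forall x, D x -> (`|g x| <= M)%R} ->
  m.-integrable D (fun x => (f x * g x)%:E).
Proof.
move=> /[dup] fi /integrableP[/measurable_EFinP mf foo] mg gM.
have mfg : measurable_fun D (f \* g)%R by exact: measurable_funM.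
have mM : measurable_fun D (fun x => (f x * Num.max M 0)%R).
  by apply: measurable_funM => //; exact: measurable_cst.
apply/integrableP; split; first exact/measurable_EFinP.
have : m.-integrable D (fun x => (f x * Num.max M 0)%:E).
  apply: (eq_integrable mD _ _ _ (integrableZr mD (Num.max M 0)%R fi)) => x _.
  by rewrite /= EFinM.
case/integrableP => _; apply: le_lt_trans.
apply: ae_ge0_le_integral => //.
- by apply: measurableT_comp => //; exact/measurable_EFinP.
- by apply: measurableT_comp => //; exact/measurable_EFinP.
- move: gM; apply: filterS => x /= gM Dx; rewrite lee_fin !normrM.
  apply: ler_wpM2l => //; rewrite (le_trans (gM Dx))//.
  by rewrite (le_trans _ (ler_norm _))// le_max lexx.
Qed.

End ae_integration.

Section product_integration.
Context d1 d2 (T1 : measurableType d1) (T2 : measurableType d2) (R : realType).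
Variable m1 : {sigma_finite_measure set T1 -> \bar R}.
Variable m2 : {sigma_finite_measure set T2 -> \bar R}.
Variables (D1 : set T1) (D2 : set T2).
Hypotheses (mD1 : measurable D1) (mD2 : measurable D2).

Let mD12 : measurable (D1 `*` D2). Proof. exact: measurableX. Qed.

(** Through this identity the Fubini theorems on the whole product pass to integrals over [D1] and
    [D2]. *)
Lemma patch_setX (f : T1 * T2 -> \bar R) x y :
  (f \_ (D1 `*` D2)) (x, y) =
  ((fun x => ((fun y => f (x, y)) \_ D2) y) \_ D1) x.
Proof.
rewrite !patchE; case: ifPn => [/[!inE] -[/= D1x D2y]|]; first by rewrite !mem_set.
move=> /negP nD; case: ifPn => // /[!inE] D1x; case: ifPn => // /[!inE] D2y.
by exfalso; apply: nD; rewrite inE.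
Qed.

Lemma patch_setX_integral1 (f : T1 * T2 -> \bar R) x :
  \int[m2]_y (f \_ (D1 `*` D2)) (x, y) =
  ((fun x => \int[m2]_(y in D2) f (x, y)) \_ D1) x.
Proof.
under eq_integral do rewrite patch_setX.
rewrite patchE; case: ifPn => D1x.
  by rewrite [RHS]integral_mkcond; apply: eq_integral => y _; rewrite patchE D1x.
by apply: integral0_eq => y _; rewrite patchE (negbTE D1x).
Qed.

Lemma patch_setX_integral2 (f : T1 * T2 -> \bar R) y :
  \int[m1]_x (f \_ (D1 `*` D2)) (x, y) =
  ((fun y => \int[m1]_(x in D1) f (x, y)) \_ D2) y.
Proof.
under eq_integral do rewrite patch_setX.
rewrite patchE; case: ifPn => D2y.
  rewrite [RHS]integral_mkcond; apply: eq_integral => x _.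
  by rewrite !patchE D2y.
by apply: integral0_eq => x _; rewrite !patchE (negbTE D2y); case: ifP.
Qed.

Lemma integral12_setX (f : T1 * T2 -> \bar R) :
  (m1 \x m2).-integrable (D1 `*` D2) f ->
  \int[m1]_(x in D1) \int[m2]_(y in D2) f (x, y) =
  \int[m1 \x m2]_(z in D1 `*` D2) f z.
Proof.
move=> /(integrable_mkcond _ mD12) fi.
rewrite [RHS]integral_mkcond -(integral12_prod_meas1 fi) [LHS]integral_mkcond.
by apply: eq_integral => x _; rewrite -patch_setX_integral1.
Qed.

Lemma integral21_setX (f : T1 * T2 -> \bar R) :
  (m1 \x m2).-integrable (D1 `*` D2) f ->
  \int[m2]_(y in D2) \int[m1]_(x in D1) f (x, y) =
  \int[m1 \x m2]_(z in D1 `*` D2) f z.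
Proof.
move=> /(integrable_mkcond _ mD12) fi.
rewrite [RHS]integral_mkcond -(integral21_prod_meas1 fi) [LHS]integral_mkcond.
by apply: eq_integral => x _; rewrite -patch_setX_integral2.
Qed.

Lemma ge0_integral12_setX (f : T1 * T2 -> \bar R) :
  measurable_fun (D1 `*` D2) f -> (forall z, 0 <= f z) ->
  \int[m1]_(x in D1) \int[m2]_(y in D2) f (x, y) =
  \int[m1 \x m2]_(z in D1 `*` D2) f z.
Proof.
move=> /(measurable_restrictT f mD12) mf f0.
rewrite [RHS]integral_mkcond fubini_tonelli1//; last first.
  by move=> z; apply: erestrict_ge0.
rewrite [LHS]integral_mkcond.
by apply: eq_integral => x _; rewrite -patch_setX_integral1.
Qed.

Lemma integrable1_setX (f : T1 * T2 -> \bar R) :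
  (m1 \x m2).-integrable (D1 `*` D2) f ->
  m1.-integrable D1 (fun x => \int[m2]_(y in D2) f (x, y)).
Proof.
move=> /(integrable_mkcond _ mD12) fi; apply/(integrable_mkcond _ mD1).
apply: (eq_integrable measurableT _ _ _ (integrable_fubini_F fi)) => x _.
exact: patch_setX_integral1.
Qed.

Lemma ae_integrable1_setX (f : T1 * T2 -> \bar R) :
  (m1 \x m2).-integrable (D1 `*` D2) f ->
  {ae m1, forall x, D1 x -> m2.-integrable D2 (fun y => f (x, y))}.
Proof.
move=> /(integrable_mkcond _ mD12) /ae_integrable1; apply: filterS => x fi D1x.
apply/(integrable_mkcond _ mD2); apply: (eq_integrable measurableT _ _ _ fi) => y _.
by rewrite patch_setX patchE mem_set.
Qed.

Lemma null_xsection (A : set (T1 * T2)) : measurable A ->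
  (forall x, m2 (xsection A x) = 0) -> (m1 \x m2) A = 0.
Proof. by move=> mA A0; apply: integral0_eq => x _; exact: A0. Qed.

(** The measure of a null set of the product is the integral of the measures of its sections; being
    nonnegative with zero integral, these vanish for almost every [x]. *)
Lemma ae_xsection (P : T1 * T2 -> Prop) : {ae m1 \x m2, forall z, P z} ->
  {ae m1, forall x, {ae m2, forall y, P (x, y)}}.
Proof.
move=> [A [mA A0 PA]].
have : \int[m1]_x `|m2 (xsection A x)| = 0.
  by rewrite -A0; apply: eq_integral => x _; rewrite gee0_abs.
move/(ae_eq_integral_abs m1 measurableT (measurable_fun_xsection m2 mA)).
apply: filterS => x /(_ I) Ax0; exists (xsection A x); split => //.
  exact: measurable_xsection.
by move=> y nP; rewrite /xsection /= inE; exact: PA.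
Qed.

End product_integration.

Section swap.
Context d (T : measurableType d) (R : realType).
Variable m : {sigma_finite_measure set T -> \bar R}.
Variables (D : set T).
Hypotheses (mD : measurable D).

Let mDD : measurable (D `*` D). Proof. exact: measurableX. Qed.

(** Integrability can be tested on the iterated integral of the absolute value in either order, and
    exchanging the arguments exchanges the two orders. *)
Lemma integrable_swap (f : T * T -> \bar R) : (m \x m).-integrable (D `*` D) f ->
  (m \x m).-integrable (D `*` D) (f \o unstable.swap).
Proof.
move=> /(integrable_mkcond _ mDD) fi; apply/(integrable_mkcond _ mDD).
have mf := measurable_int _ fi.
have -> : (f \o unstable.swap) \_ (D `*` D) = (f \_ (D `*` D)) \o unstable.swap.
  apply/funext => -[x y]; rewrite /= !patchE /=.
  by congr (if _ then _ else _); apply/idP/idP; rewrite !inE => -[].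
apply/integrable21ltyP.
  by apply: measurableT_comp => //; exact: measurable_swap.
exact/integrable12ltyP.
Qed.

Lemma integral_swap (f : T * T -> \bar R) : (m \x m).-integrable (D `*` D) f ->
  \int[m \x m]_(z in D `*` D) f (unstable.swap z) = \int[m \x m]_(z in D `*` D) f z.
Proof.
move=> fi; rewrite -(integral21_setX mD mD fi).
by rewrite -(integral12_setX mD mD (integrable_swap fi)).
Qed.

End swap.

Section product_measurability.
Context d1 d2 (T1 : measurableType d1) (T2 : measurableType d2) (R : realType).
Variable m1 : {sigma_finite_measure set T1 -> \bar R}.
Variable m2 : {sigma_finite_measure set T2 -> \bar R}.
Variables (D1 : set T1) (D2 : set T2).
Hypotheses (mD1 : measurable D1) (mD2 : measurable D2).

Lemma measurable_fst_setX d (T : measurableType d) (g : T1 -> T) :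
  measurable_fun D1 g -> measurable_fun (D1 `*` D2) (fun z => g z.1).
Proof.
move=> mg; apply: (measurable_comp mD1 _ mg); first by move=> _ [z [? _] <-].
exact: measurable_funTS measurable_fst.
Qed.

Lemma measurable_snd_setX d (T : measurableType d) (g : T2 -> T) :
  measurable_fun D2 g -> measurable_fun (D1 `*` D2) (fun z => g z.2).
Proof.
move=> mg; apply: (measurable_comp mD2 _ mg); first by move=> _ [z [_ ?] <-].
exact: measurable_funTS measurable_snd.
Qed.

Lemma measurable_section_setX d (T : measurableType d) (f : T1 * T2 -> T) x :
  D1 x -> measurable_fun (D1 `*` D2) f -> measurable_fun D2 (fun y => f (x, y)).
Proof.
move=> D1x mf; apply: (measurable_comp (measurableX mD1 mD2) _ mf).
  by move=> _ [y D2y <-].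
by apply: measurable_funTS; exact: measurable_pair1.
Qed.

Lemma ae_fst (P : T1 -> Prop) : {ae m1, forall x, P x} ->
  {ae m1 \x m2, forall z, P z.1}.
Proof.
move=> [A [mA A0 PA]]; exists (A `*` setT); split.
- exact: measurableX.
- transitivity (m1 A * m2 setT); first exact: product_measure1E.
  by rewrite A0 mul0e.
- by move=> z nP; split => //; exact: PA.
Qed.

Lemma ae_snd (P : T2 -> Prop) : {ae m2, forall x, P x} ->
  {ae m1 \x m2, forall z, P z.2}.
Proof.
move=> [A [mA A0 PA]]; exists (setT `*` A); split.
- exact: measurableX.
- transitivity (m1 setT * m2 A); first exact: product_measure1E.
  by rewrite A0 mule0.
- by move=> z nP; split => //; exact: PA.
Qed.

(** Merges null sets that depend on [x] into one null set of the product. Measurability of [A] makes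
    its product measure the integral of the section measures. *)
Lemma ae_of_section (A : set (T1 * T2)) : measurable A ->
  (forall x, {ae m2, forall y, ~ A (x, y)}) -> {ae m1 \x m2, forall z, ~ A z}.
Proof.
move=> mA A0; exists A; split => //; last by move=> z /contrapT.
apply: null_xsection => // x; have [B [mB B0 BA]] := A0 x.
apply: (subset_measure0 _ mB _ B0); first exact: measurable_xsection.
by move=> y; rewrite /xsection /= inE => Axy; apply: BA => /=; exact.
Qed.

Lemma ge0_measurable_integral1_setX (f : T1 * T2 -> \bar R) :
  measurable_fun (D1 `*` D2) f -> (forall z, 0 <= f z) ->
  measurable_fun D1 (fun x => \int[m2]_(y in D2) f (x, y)).
Proof.
move=> /(measurable_restrictT f (measurableX mD1 mD2)) mf f0.
apply/(measurable_restrictT _ mD1).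
have := measurable_fun_fubini_tonelli_F (m2 := m2) _ mf.
rewrite (_ : fubini_F m2 _ = (fun x => \int[m2]_(y in D2) f (x, y)) \_ D1).
  by apply => z; exact: erestrict_ge0.
by apply/funext => x; exact: patch_setX_integral1.
Qed.

End product_measurability.

Lemma ae_exists d (T : measurableType d) (R : realType)
    (m : {measure set T -> \bar R}) (A : set T) (P : T -> Prop) :
  measurable A -> 0 < m A -> {ae m, forall x, A x -> P x} -> exists2 x, A x & P x.
Proof.
move=> mA A0 [B [mB B0 BP]]; apply: contrapT => nP.
move: A0; rewrite (subset_measure0 _ mB _ B0) ?ltxx// => x Ax.
by apply: BP => /= /(_ Ax) Px; apply: nP; exists x.
Qed.

(** Where [rho] is negative, the integral of [|rho|] is minus that of [rho], hence at most 0; so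
    [rho] would be 0 almost everywhere on that set, which must then be null. *)
Lemma integrable_ge0_ae d (T : measurableType d) (R : realType)
    (m : {measure set T -> \bar R}) (D : set T) (rho : T -> R) :
  measurable D -> m.-integrable D (EFin \o rho) ->
  (forall A, measurable A -> A `<=` D -> 0 <= \int[m]_(x in A) (rho x)%:E) ->
  {ae m, forall x, D x -> (0 <= rho x)%R}.
Proof.
move=> mD irho rho0; have /measurable_EFinP mrho := measurable_int _ irho.
pose A := D `&` rho @^-1` `]-oo, 0%R[.
have mA : measurable A by apply: mrho => //; exact: measurable_itv.
have AD : A `<=` D by move=> x [].
have rhoA x : A x -> (rho x < 0)%R by move=> [_] /=; rewrite in_itv.
have iA : m.-integrable A (EFin \o rho) by exact: integrableS irho.
have : \int[m]_(x in A) `|(rho x)%:E| = 0.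
  apply/eqP; rewrite eq_le integral_ge0// andbT.
  rewrite (eq_integral (fun x => - (rho x)%:E)); last first.
    by move=> x /[!inE] /rhoA r0; rewrite /= ltr0_norm.
  rewrite integralN; last by apply: integrable_add_def.
  by rewrite oppe_le0; exact: rho0.
move/(ae_eq_integral_abs m mA (measurable_int _ iA)); apply: filterS => x /= Ax Dx.
rewrite leNgt; apply/negP => r0.
have /Ax [r00] : A x by split => //=; rewrite in_itv.
by move: r0; rewrite r00 ltxx.
Qed.

(** * Euclidean norm and Lebesgue measure *)

Section euclidean_norm.
Local Open Scope ring_scope.
Variables (R : realType) (N : nat).
Local Notation E := 'rV[R]_N.
Implicit Types (x y : E) (r : R).

Lemma enormB x y : enorm (x - y) = enorm (y - x).
Proof.
rewrite /enorm; congr Num.sqrt; apply: eq_bigr => i _.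
by rewrite !mxE -sqrrN opprB.
Qed.

Lemma sum_sqr_ge0 x : 0 <= \sum_(i < N) x 0 i ^+ 2.
Proof. by apply: sumr_ge0 => i _; exact: sqr_ge0. Qed.

Lemma continuous_enormB x : continuous (fun y => enorm (x - y)).
Proof.
have cc i : continuous (fun z : E => x 0 i - z 0 i).
  move=> z; apply: continuousB; first exact: cst_continuous.
  exact: coord_continuous.
have cq i : continuous (fun z : E => (x 0 i - z 0 i) ^+ 2).
  move=> z; exact: (continuousM (@cc i z) (@cc i z)).
have cs : continuous (fun z : E => \sum_(i < N) (x 0 i - z 0 i) ^+ 2).
  move=> z; apply: (@cvg_big _ _ _ _ _ _ _ (nbhs z)) => [|i _].
    exact: add_continuous.
  exact: cq.
rewrite (_ : (fun _ => _) =
    Num.sqrt \o (fun z : E => \sum_(i < N) (x 0 i - z 0 i) ^+ 2)).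
  by move=> y; apply: continuous_comp; [exact: cs|exact: sqrt_continuous].
apply/funext => y; rewrite /enorm /=; congr Num.sqrt; apply: eq_bigr => i _.
by rewrite !mxE.
Qed.

Lemma closure_eball x r : closure (eball x r) `<=` [set y | enorm (x - y) <= r].
Proof.
have /closure_id -> : closed [set y | enorm (x - y) <= r].
  apply: (@closed_comp _ _ (fun y => enorm (x - y)) [set t | t <= r]).
    by move=> y _; exact: continuous_enormB.
  exact: closed_le.
by apply: closureS => y; rewrite /eball/= => /ltW.
Qed.

(* [ball] is a ball of the sup norm. *)
Lemma ball_eball r : 0 < r ->
  exists2 delta, 0 < delta & forall x, ball x delta `<=` eball x r.
Proof.
(* A sum of [N] squares, each at most [(r / N.+1) ^+ 2], stays strictly below [r ^+ 2] since
   [N < N.+1 ^ 2]. *)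
move=> r0; exists (r / N.+1%:R); first by rewrite divr_gt0.
move=> x y [_ xy]; rewrite /eball /enorm /=.
rewrite -[ltRHS]gtr0_norm// -sqrtr_sqr ltr_sqrt ?exprn_gt0//.
apply: (@le_lt_trans _ _ (\sum_(i < N) (r / N.+1%:R) ^+ 2)).
  apply: ler_sum => i _; rewrite !mxE -real_normK ?num_real//.
  by rewrite lerXn2r ?nnegrE ?divr_ge0 ?(ltW r0)// ltW//; exact: xy.
rewrite sumr_const card_ord expr_div_n -[ltLHS]mulr_natr -mulrA gtr_pMr ?exprn_gt0//.
rewrite mulrC ltr_pdivrMr ?exprn_gt0// mul1r -natrX ltr_nat.
by rewrite (@leq_trans N.+1)// leq_pmulr.
Qed.

Lemma measurable_enormB :
  measurable_fun [set: E * E] (fun z => enorm (z.1 - z.2)).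
Proof.
apply: (measurableT_comp (continuous_measurable_fun (@sqrt_continuous R))).
apply: measurable_sum => i; apply: measurable_funX.
rewrite (_ : (fun _ => _) = (fun z : E * E => z.1 0 i - z.2 0 i)); last first.
  by apply/funext => z; rewrite !mxE.
apply: measurable_funB.
  exact: (measurableT_comp (measurable_coord i) measurable_fst).
exact: (measurableT_comp (measurable_coord i) measurable_snd).
Qed.

Lemma measurable_eball_rel r :
  measurable [set z : E * E | enorm (z.1 - z.2) < r].
Proof.
have := measurable_enormB measurableT (measurable_itv `]-oo, r[).
by rewrite setTI; congr measurable; apply/seteqP; split => z /=; rewrite in_itv.
Qed.

Lemma measurable_eball x r : measurable (eball x r).
Proof.
have := measurable_xsection x (measurable_eball_rel r).
by congr measurable; apply/seteqP; split => y; rewrite /xsection /= inE.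
Qed.

Lemma measurable_sphere_sqr x r :
  measurable [set y : E | \sum_(i < N) (x 0 i - y 0 i) ^+ 2 = r].
Proof.
have mf : measurable_fun setT (fun y : E => \sum_(i < N) (x 0 i - y 0 i) ^+ 2).
  apply: measurable_sum => i; apply: measurable_funX.
  by apply: measurable_funB => //; exact: measurable_coord.
have := mf measurableT [set r] (measurable_set1 r).
by rewrite setTI.
Qed.

End euclidean_norm.

Section lebesgue_rV_facts.
Variable R : realType.

(** With all coordinates but the first fixed, the equation reads [(x 0 0 - t) ^+ 2 = c] and has at
    most two solutions [t]. Dimension 0 is excluded because the measure there is a Dirac mass. Here
    [r] is the squared radius. *)
Lemma lebesgue_rV_sphere_sqr N (x : 'rV[R]_N) (r : R) : (0 < N)%N ->
  lebesgue_rV R N [set y : 'rV[R]_N | (\sum_(i < N) (x 0 i - y 0 i) ^+ 2)%R = r] = 0.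
Proof.
case: N x => // n x _; set S := [set _ | _].
have mS : measurable (@rV_cons R n @^-1` S).
  rewrite -[X in measurable X]setTI; apply: measurable_rV_cons => //.
  exact: measurable_sphere_sqr.
rewrite /= /lebesgue_rV_step /pushforward.
(* [\x] integrates the measures of sections at a fixed first coordinate; the argument needs sections
   at a fixed tail [v], hence the reversed product [\x^]. *)
rewrite (product_measure_unique (m' := (@lebesgue_measure R \x^ lebesgue_rV R n)))//.
  apply: integral0_eq => v _; apply: countable_lebesgue_measure0.
  pose c := (r - \sum_(i < n) (x 0 (lift ord0 i) - v 0 i) ^+ 2)%R.
  apply: (@sub_countable _ _ _ [set (x 0 0 - Num.sqrt c)%R; (x 0 0 + Num.sqrt c)%R]).
    apply: subset_card_le => t; rewrite /ysection /= inE /S /=.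
    rewrite big_ord_recl rV_cons0/=.
    under eq_bigr.
      move=> i _.
      rewrite [X in rV_cons _ _ X](_ : _ = rshift 1 i); last exact: val_inj.
      rewrite rV_consS; over.
    move=> /= /(canRL (addrK _)); rewrite -/c => xtc.
    have : (`|x 0 0 - t| = Num.sqrt c)%R by rewrite -xtc sqrtr_sqr.
    have [_ <-|_ <-] := ger0P (x 0 0 - t)%R.
      by left; rewrite opprB addrC subrK.
    by right; rewrite opprB addrC subrK.
  by apply: finite_set_countable; exact: finite_set2.
by move=> A B mA mB; exact: product_measure2E.
Qed.

Lemma lebesgue_rV_sphere N (x : 'rV[R]_N) (r : R) : (0 < N)%N ->
  (lebesgue_rV R N).-negligible [set y : 'rV[R]_N | enorm (x - y) = r].
Proof.
move=> N0.
exists [set y : 'rV[R]_N | (\sum_(i < N) (x 0 i - y 0 i) ^+ 2)%R = (r ^+ 2)%R].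
split; [exact: measurable_sphere_sqr|exact: lebesgue_rV_sphere_sqr|].
move=> y /= <-; rewrite sqr_sqrtr ?sum_sqr_ge0//.
by apply: eq_bigr => i _; rewrite !mxE.
Qed.

Lemma lebesgue_rV_bounded N (A : set 'rV[R]_N) : measurable A -> bounded_set A ->
  lebesgue_rV R N A < +oo.
Proof.
move=> mA [M [Mreal bA]].
(* [bA] bounds the norm only by numbers strictly above [M]. *)
pose c := (M + 1)%R.
have {}bA v : A v -> forall i, `[(- c)%R, c]%classic (v 0%R i).
  move=> Av i; rewrite /= in_itv /= -ler_norml.
  have /= := bA c; rewrite ltrDl => /(_ ltr01 _ Av).
  apply: le_trans; rewrite [leRHS]mx_normrE.
  exact: (Order.TotalTheory.le_bigmax _ (fun ij => `|v ij.1 ij.2|%R) (0%R, i)).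
have mB (i : 'I_N) : measurable `[(- c)%R, c]%classic by exact: measurable_itv.
apply: (@le_lt_trans _ _ (lebesgue_rV R N
   [set v | forall i, `[(- c)%R, c]%classic (v 0%R i)])).
  apply: le_measure; rewrite ?inE//.
  exact: (measurable_box (fun i => mB i)).
rewrite (lebesgue_rV_box mB).
suff : \prod_(i < N) lebesgue_measure `[(- c)%R, c]%classic \is a fin_num.
  by rewrite ge0_fin_numE// prode_ge0.
apply: prode_fin_num => i _.
by rewrite lebesgue_measure_itv /=; case: ifP.
Qed.

Lemma lebesgue_rV_ball_gt0 N (x : 'rV[R]_N) (r : R) : (0 < r)%R ->
  0 < lebesgue_rV R N (ball x r).
Proof.
move=> r0; rewrite (_ : ball x r = [set v | forall i, (ball (x 0%R i) r) (v 0%R i)]).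
  rewrite (lebesgue_rV_box (fun i => measurable_ball _ _)).
  apply: (@big_ind _ (fun a => 0 < a)) => [|a b|i _].
  - exact: lte01.
  - exact: mule_gt0.
  rewrite ball_itv lebesgue_measure_itv /= lte_fin ltrD2l gtrN//.
  by rewrite -EFinB lte_fin subr_gt0 ltrD2l gtrN.
apply/seteqP; split => v; first by move=> [_ xv] i; exact: xv.
by move=> xv; split => // i j; rewrite ord1; exact: xv.
Qed.

Lemma lebesgue_rV_open_gt0 N (A : set 'rV[R]_N) : open A -> A !=set0 ->
  0 < lebesgue_rV R N A.
Proof.
move=> oA [x Ax]; have /nbhs_ballP[e /= e0 eA] : nbhs x A by exact: open_nbhs_nbhs.
apply: (lt_le_trans (lebesgue_rV_ball_gt0 x e0)).
apply: le_measure; rewrite ?inE//; apply: open_measurable_rV => //.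
exact: ball_open.
Qed.

(* Lindelof: countably many rational balls, each contained in one of the open
   sets on which [u] vanishes, cover the complement of the support. *)
Lemma ess_supp_ae N (Omega : set 'rV[R]_N) (u : 'rV[R]_N -> R) :
  {ae lebesgue_rV R N, forall x, Omega x -> ~ ess_supp Omega u x -> u x = 0%R}.
Proof.
pose V (p : 'rV[rat]_N * nat) := ball (map_mx ratr p.1 : 'rV[R]_N) p.2.+1%:R^-1.
pose good (p : 'rV[rat]_N * nat) :=
  {ae lebesgue_rV R N, forall x, (Omega `&` V p) x -> u x = 0%R}.
have H : {ae lebesgue_rV R N, forall x, forall p : 'rV[rat]_N * nat,
    good p -> (Omega `&` V p) x -> u x = 0%R}.
  (* Countably many almost-everywhere statements are merged along [nat], so the rational balls are
     enumerated by [unpickle]. *)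
  have : {ae lebesgue_rV R N, forall x, forall n : nat,
      forall p : 'rV[rat]_N * nat, unpickle n = Some p -> good p ->
      (Omega `&` V p) x -> u x = 0%R}.
    apply/ae_foralln => n; case: unpickle => [p|]; last exact: nearW.
    have [gp|ngp] := pselect (good p); last by apply: nearW => x q [<-] /ngp.
    by move: gp; apply: filterS => x ? q [<-].
  apply: filterS => x Hx p; exact: (Hx _ _ (pickleK p)).
apply: filterS H => x Hx Ox /contrapT[U [oU uU] Ux].
move: (Ux); rewrite [X in X x](open_bigcup_ball oU) => -[p pU px].
apply: (Hx p) => //; move: uU; apply: filterS => y uU [Oy py].
by apply: uU; split => //; exact: pU.
Qed.

End lebesgue_rV_facts.

(** * Nonlocal integration by parts *)

Section by_parts.
Variables (R : realType) (N : nat) (eps : R) (Omega : set 'rV[R]_N).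
Local Notation E := 'rV[R]_N.
Local Notation lam := (lebesgue_rV R N).
Local Notation lam2 := (lam \x lam).
Local Notation Omega2 := (Omega `*` Omega).
Hypothesis mO : measurable Omega.
Let mO2 : measurable Omega2. Proof. exact: measurableX. Qed.

(** The relation whose sections are the balls: its indicator turns an integral over [eball y eps]
    into one over all of [Omega], where Fubini on [Omega2] applies. *)
Definition near_diag : set (E * E) := [set z | (enorm (z.1 - z.2) < eps)%R].

Lemma measurable_near_diag : measurable near_diag.
Proof. exact: measurable_eball_rel. Qed.

Lemma near_diag_swap z : \1_near_diag (unstable.swap z) = \1_near_diag z :> R.
Proof.
by case: z => x y; rewrite !indicE; congr (_%:R); congr nat_of_bool;
  apply/idP/idP; rewrite !inE /near_diag /= enormB.
Qed.

Definition ess_bounded (u : E -> R) (M : R) :=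
  {ae lam, forall x, Omega x -> (`|u x| <= M)%R}.

Lemma integrable_mul_fst (f : E * E -> R) (u : E -> R) M :
  lam2.-integrable Omega2 (EFin \o f) -> measurable_fun Omega u ->
  ess_bounded u M -> lam2.-integrable Omega2 (fun z => (f z * u z.1)%:E).
Proof.
move=> fi mu uM; apply: (@integrableM_ae_bounded _ _ _ _ _ mO2 _ _ M) => //.
  exact: measurable_fst_setX.
by have := ae_fst lam uM; apply: filterS => z /= uz [/uz].
Qed.

Lemma integrable_mul_snd (f : E * E -> R) (u : E -> R) M :
  lam2.-integrable Omega2 (EFin \o f) -> measurable_fun Omega u ->
  ess_bounded u M -> lam2.-integrable Omega2 (fun z => (f z * u z.2)%:E).
Proof.
move=> fi mu uM; apply: (@integrableM_ae_bounded _ _ _ _ _ mO2 _ _ M) => //.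
  exact: measurable_snd_setX.
by have := ae_snd lam uM; apply: filterS => z /= uz [_ /uz].
Qed.

Lemma integrable_mul_grad (f : E * E -> R) (u : E -> R) M :
  lam2.-integrable Omega2 (EFin \o f) -> measurable_fun Omega u ->
  ess_bounded u M ->
  lam2.-integrable Omega2 (fun z => (f z * grad_eps eps u z)%:E).
Proof.
move=> fi mu uM.
have := integrableZr mO2 eps^-1%R
  (integrableB mO2 (integrable_mul_snd fi mu uM) (integrable_mul_fst fi mu uM)).
apply: eq_integrable => // z _.
by rewrite /= -EFinB -EFinM /grad_eps mulrA mulrBr.
Qed.

(** The relation is symmetric, so one cutoff serves both [f (y, x)] and [f (x, y)]. *)
Lemma div_eps_indic (f : E * E -> R) y :
  div_eps Omega eps f y =
  \int[lam]_(x in Omega) ((f (y, x) * \1_near_diag (y, x)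
    - f (x, y) * \1_near_diag (x, y)) / eps)%:E.
Proof.
rewrite /div_eps integral_mkcondl; apply: eq_integral => x _.
rewrite patchE -(near_diag_swap (x, y)) -mulrBl indicE /=.
rewrite (_ : ((y, x) \in near_diag) = (x \in eball y eps)); last first.
  by apply/idP/idP; rewrite !inE.
by case: ifP => _; rewrite ?mulr1// mulr0 mul0r.
Qed.

(** Stated for any integrable [f] carried by the strip, so that it serves both [weight] and the
    signed [weight2]. *)
Lemma integral_div_eps (f : E * E -> R) (u : E -> R) M :
  lam2.-integrable Omega2 (EFin \o f) ->
  {ae lam2, forall z, Omega2 z -> ~ near_diag z -> f z = 0%R} ->
  measurable_fun Omega u -> ess_bounded u M ->
  \int[lam]_(y in Omega) ((u y)%:E * div_eps Omega eps f y) =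
  - \int[lam2]_(z in Omega2) (f z * grad_eps eps u z)%:E.
Proof.
move=> fi f0 mu uM.
pose g z := (f z * \1_near_diag z)%R.
have gi : lam2.-integrable Omega2 (EFin \o g).
  apply: (@integrableM_ae_bounded _ _ _ _ _ mO2 _ _ 1%R) => //.
    by apply: measurable_funTS; exact: measurable_indic measurable_near_diag.
  by apply: nearW => z _; rewrite indicE; case: (_ \in _); rewrite ?normr1 ?normr0.
have fg : ae_eq lam2 Omega2 (EFin \o f) (EFin \o g).
  move: f0; apply: filterS => z fz Oz; rewrite /= /g indicE.
  have [nz|nz] := boolP (z \in near_diag); first by rewrite mulr1.
  by rewrite fz ?mul0r// => nz'; move/negP: nz; apply; rewrite inE.
pose h z := ((g z - g (unstable.swap z)) / eps)%R.
have hi : lam2.-integrable Omega2 (EFin \o h).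
  have := integrableZr mO2 eps^-1%R (integrableB mO2 gi (integrable_swap mO gi)).
  by apply: eq_integrable => // z _; rewrite /= -EFinB -EFinM.
have hui := integrable_mul_fst hi mu uM.
have gu1 := integrable_mul_fst gi mu uM.
have gu2 := integrable_mul_snd gi mu uM.
(* Moving [u y] under the inner integral needs [h (y, .)] integrable, which Fubini grants only for
   almost every [y]. *)
transitivity (\int[lam]_(y in Omega) \int[lam]_(x in Omega) (h (y, x) * u y)%:E).
  apply: ae_eq_integral => //.
  - apply: emeasurable_funM; first exact/measurable_EFinP.
    have := measurable_int _ (integrable1_setX mO mO hi).
    by apply: eq_measurable_fun => y _; rewrite div_eps_indic.
  - exact: measurable_int (integrable1_setX mO mO hui).
  - have := ae_integrable1_setX mO mO hi; apply: filterS => y hyi Oy.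
    rewrite div_eps_indic muleC -integralZr//; last exact: hyi.
rewrite (integral12_setX mO mO hui).
transitivity (\int[lam2]_(z in Omega2) ((g z * u z.1)%:E * eps^-1%:E) -
  \int[lam2]_(z in Omega2) ((g z * u z.2)%:E * eps^-1%:E)).
  (* Only the second half of [h] is swapped: [g (unstable.swap z) * u z.1] is [g z * u z.2] after
     exchanging the variables. *)
  rewrite -[X in _ - X](integral_swap mO); last exact: integrableZr.
  rewrite -integralB//; last 2 first.
  - exact: integrableZr.
  - apply: (integrable_swap mO (f := fun z => (g z * u z.2)%:E * eps^-1%:E)).
    exact: integrableZr.
  apply: eq_integral => z _ /=; rewrite -!EFinM -EFinB.
  by rewrite /h mulrAC -mulrBl -mulrBl.
rewrite -integralB//; [|exact: integrableZr..].
transitivity (\int[lam2]_(z in Omega2) - (g z * grad_eps eps u z)%:E).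
  apply: eq_integral => z _; rewrite -!EFinM -EFinB -EFinN.
  by rewrite -mulrBl -mulrBr -mulrA -mulrN -mulNr opprB.
rewrite integralN; last first.
  exact: (integrable_add_def mO2 (integrable_mul_grad gi mu uM)).
congr (- _); apply: ae_eq_integral => //.
- exact: measurable_int (integrable_mul_grad gi mu uM).
- exact: measurable_int (integrable_mul_grad fi mu uM).
- by move: fg; apply: filterS => z fg Oz; have [->] := fg Oz.
Qed.

End by_parts.

(** * Admissible kernels *)

Section kernels.
Variables (R : realType) (N : nat) (eps : R) (Omega : set 'rV[R]_N).
Local Notation E := 'rV[R]_N.
Local Notation lam := (lebesgue_rV R N).
Local Notation lam2 := (lam \x lam).
Local Notation Omega2 := (Omega `*` Omega).
Hypothesis mO : measurable Omega.
Let mO2 : measurable Omega2. Proof. exact: measurableX. Qed.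
Implicit Types (K Psi : E * E -> R).

(** The density of a Markov kernel. Its sign is required everywhere, for Tonelli; its mass only for
    almost every [x], as it is transferred from another representative by [ae_xsection]. *)
Definition transition_density K :=
  [/\ measurable_fun Omega2 K, forall z, (0 <= K z)%R &
      {ae lam, forall x, Omega x -> \int[lam]_(y in Omega) (K (x, y))%:E = 1}].

Definition local_kernel K := forall z, ~ near_diag eps z -> K z = 0%R.

Lemma admissible_kernel Psi : (0 < N)%N -> admissible Omega eps Psi ->
  exists2 K, transition_density K /\ local_kernel K &
    {ae lam2, forall z, Omega2 z -> Psi z = K z}.
Proof.
move=> N0 [iPsi Psi0 [P [mP PPsi P1]]].
(* The maximum forces the sign and the indicator the locality at every point; what remains is that
   [P] changes only on a null set. *)
pose K z := (Num.max (P z) 0 * \1_(near_diag eps) z)%R.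
have mK : measurable_fun Omega2 K.
  apply: measurable_funM.
    by apply: measurable_maxr => //; exact: measurable_cst.
  by apply: measurable_funTS; apply: measurable_indic; exact: measurable_near_diag.
have K0 z : (0 <= K z)%R.
  by rewrite /K mulr_ge0 ?le_max ?lexx ?orbT// indicE.
have Kfar : local_kernel K.
  by move=> z nz; rewrite /K indicE memNset// mulr0.
(* The mass of [P] cut off by the indicator. Each section is null: by the support condition it lies,
   up to a null set, in the closed ball, so on the sphere. *)
pose A := (Omega2 `\` near_diag eps) `&` (P @^-1` (~` [set 0%R])).
have mA : measurable A.
  rewrite /A setDE setIAC; apply: measurableI; last first.
    by apply: measurableC; exact: measurable_near_diag.
  by apply: mP => //; exact: measurableC.
have A0 x : {ae lam, forall y, ~ A (x, y)}.
  have [Ox|nOx] := pselect (Omega x); last first.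
    by apply: nearW => y [[[]]].
  have [_ supp] := P1 x Ox.
  have sph : {ae lam, forall y, enorm (x - y) <> eps}.
    have := lebesgue_rV_sphere x eps N0.
    by apply: negligibleS => y /= /contrapT.
  move: sph (ess_supp_ae Omega (fun y => P (x, y))).
  apply: filterS2 => y ne supp0 [[[_ Oy] far] Pn0]; apply: Pn0.
  apply: supp0 => // /supp [/closure_eball/= + _].
  rewrite le_eqVlt => /orP[/eqP //|]; exact: far.
have PK : {ae lam2, forall z, Omega2 z -> P z = K z}.
  move: (ae_of_section lam mA A0) PPsi Psi0; apply: filterS3 => z nA PPsi Psi0 Oz.
  have Pz0 : (0 <= P z)%R by rewrite PPsi// Psi0.
  rewrite /K max_l// indicE.
  have [nz|/negP nz] := boolP (z \in near_diag eps); first by rewrite mulr1.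
  rewrite mulr0; apply: contrapT => Pn0; apply: nA; split => //; split => //.
  by move=> nz'; apply: nz; rewrite inE.
exists K; last by move: PPsi PK; apply: filterS2 => z PPsi PK Oz; rewrite -PPsi// PK.
split => //; split => //.
have := ae_xsection PK; apply: filterS => x PKx Ox.
rewrite -(P1 x Ox).1; apply: ae_eq_integral => //.
- by apply/measurable_EFinP; exact: measurable_section_setX mK.
- by apply/measurable_EFinP; exact: measurable_section_setX mP.
- by move: PKx; apply: filterS => y Pxy Oy; rewrite Pxy.
Qed.

Lemma integrable_transition_density_section K : transition_density K ->
  {ae lam, forall x, Omega x ->
    lam.-integrable Omega (fun y => (K (x, y))%:E)}.
Proof.
move=> [mK K0 K1]; move: K1; apply: filterS => x K1 Ox.
apply/integrableP; split.
  by apply/measurable_EFinP; exact: measurable_section_setX mK.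
under eq_integral do rewrite gee0_abs ?lee_fin//.
by rewrite K1// ltry.
Qed.

(** By Tonelli the inner mass 1 reduces the double integral of [|K g|] to that of [|g|], so [g] need
    not be bounded. *)
Lemma integrable_transition_density K (g : E -> R) : transition_density K ->
  lam.-integrable Omega (EFin \o g) ->
  lam2.-integrable Omega2 (fun z => (K z * g z.1)%:E).
Proof.
move=> kK gi; have [mK K0 K1] := kK.
have /measurable_EFinP mg := measurable_int _ gi.
have mKg : measurable_fun Omega2 (fun z => (K z * g z.1)%R).
  by apply: measurable_funM => //; exact: measurable_fst_setX.
have mKg' : measurable_fun Omega2 (fun z => `|(K z * g z.1)%:E|).
  by apply: measurableT_comp => //; exact/measurable_EFinP.
apply/integrableP; split; first exact/measurable_EFinP.
rewrite -(ge0_integral12_setX lam lam mO mO mKg')//.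
have /integrableP[_] := gi; apply: le_lt_trans.
rewrite le_eqVlt; apply/orP; left; apply/eqP.
apply: ae_eq_integral => //.
- by apply: (ge0_measurable_integral1_setX lam mO mO mKg').
- by apply: measurableT_comp => //; exact/measurable_EFinP.
- move: K1 (integrable_transition_density_section kK).
  apply: filterS2 => x K1 iK Ox.
  under eq_integral do rewrite /= normrM (ger0_norm (K0 _)) EFinM.
  by rewrite integralZr ?K1 ?mul1e//; exact: iK.
Qed.

Lemma integral_transition_density K (g : E -> R) : transition_density K ->
  lam.-integrable Omega (EFin \o g) ->
  \int[lam2]_(z in Omega2) (K z * g z.1)%:E = \int[lam]_(x in Omega) (g x)%:E.
Proof.
move=> kK gi; have [mK K0 K1] := kK.
have Kgi := integrable_transition_density kK gi.
rewrite -(integral12_setX mO mO Kgi); apply: ae_eq_integral => //.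
- exact: measurable_int (integrable1_setX mO mO Kgi).
- exact: measurable_int gi.
- move: K1 (integrable_transition_density_section kK).
  apply: filterS2 => x K1 iK Ox.
  under eq_integral do rewrite /= EFinM.
  by rewrite integralZr ?K1 ?mul1e//; exact: iK.
Qed.

End kernels.

(** * Essential suprema over balls *)

Section essential_supremum_ball.
Variables (R : realType) (N : nat) (eps : R) (Omega : set 'rV[R]_N).
Local Notation E := 'rV[R]_N.
Local Notation lam := (lebesgue_rV R N).
Local Notation lam2 := (lam \x lam).
Local Notation Omega2 := (Omega `*` Omega).
Hypotheses (eps0 : (0 < eps)%R) (oO : open Omega).
Implicit Types (u : E -> R).
Let mO : measurable Omega. Proof. exact: open_measurable_rV. Qed.
Let mO2 : measurable Omega2. Proof. exact: measurableX. Qed.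

(** [fine] loses nothing on [Omega] when [u] is essentially bounded, by [sup_ballE]. *)
Definition sup_ball u (x : E) : R := fine (ess_sup_on lam (eball x eps `&` Omega) u).

Lemma Linfty_ess_bounded u : Linfty lam Omega u ->
  measurable_fun Omega u /\ exists M, ess_bounded Omega u M.
Proof.
move=> [mu /ereal_inf_lt[y yub ylt]]; split => //.
move: y yub ylt => [r| |]//= yub _.
  by exists r; move: yub; apply: filterS => x /= ux /ux; rewrite lee_fin.
by exists 0%R; move: yub; apply: filterS => x /= ux /ux; rewrite leeNy_eq.
Qed.

Let mball x : measurable (eball x eps `&` Omega).
Proof. by apply: measurableI => //; exact: measurable_eball. Qed.

Lemma eball_Omega_gt0 x : Omega x -> 0 < lam (eball x eps `&` Omega).
Proof.
move=> Ox; have [delta delta0 near_eball] := ball_eball N eps0.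
apply: (@lt_le_trans _ _ (lam (ball x delta `&` Omega))).
  apply: lebesgue_rV_open_gt0; first by apply: openI => //; exact: ball_open.
  by exists x; split => //; exact: ballxx.
apply: le_measure; rewrite ?inE//.
  by apply: measurableI => //; apply: open_measurable_rV; exact: ball_open.
by apply: setSI; exact: near_eball.
Qed.

Lemma sup_ballE u M x : ess_bounded Omega u M -> Omega x ->
  ess_sup_on lam (eball x eps `&` Omega) u = (sup_ball u x)%:E.
Proof.
move=> uM Ox; rewrite /sup_ball fineK// fin_numElt; apply/andP; split.
  apply: (@lt_le_trans _ _ (- M)%:E); first exact: ltNyr.
  apply: le_ereal_inf_tmp => y /= uy.
  (* The inequality does not involve [z]: true almost everywhere on a set of positive measure, it is
     true. *)
  have : {ae lam, forall z, (eball x eps `&` Omega) z -> (- M)%:E <= y}.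
    move: uM uy; apply: filterS2 => z uM uy zx; apply: le_trans (uy zx).
    by rewrite lee_fin; have := uM zx.2; rewrite ler_norml => /andP[].
  by move=> /(ae_exists (mball x) (eball_Omega_gt0 Ox))[].
apply: (@le_lt_trans _ _ M%:E); last exact: ltry.
apply: ereal_inf_lbound => /=; move: uM; apply: filterS => z uM [_ Oz].
by rewrite lee_fin (le_trans (ler_norm _))// uM.
Qed.

Lemma sup_ball_le u M x (r : R) : ess_bounded Omega u M -> Omega x ->
  (sup_ball u x <= r)%R <->
  {ae lam, forall y, (eball x eps `&` Omega) y -> (u y <= r)%R}.
Proof.
move=> uM Ox; rewrite -lee_fin -(sup_ballE uM Ox) (ess_sup_onE _ (mball x)).
split.
  move=> /ess_supP /ae_mrestrE; apply: filterS => y uy /uy.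
  by rewrite /= lee_fin.
move=> uy; apply/ess_supP/ae_mrestrE; move: uy; apply: filterS => y uy /uy.
by rewrite /= lee_fin.
Qed.

Lemma sup_ball_ae u M x : ess_bounded Omega u M -> Omega x ->
  {ae lam, forall y, (eball x eps `&` Omega) y -> (u y <= sup_ball u x)%R}.
Proof. by move=> uM Ox; apply/(sup_ball_le _ uM Ox). Qed.

Lemma sup_ball_bounded u M x : ess_bounded Omega u M -> Omega x ->
  (`|sup_ball u x| <= M)%R.
Proof.
move=> uM Ox; rewrite ler_norml; apply/andP; split.
  have H : {ae lam, forall y, (eball x eps `&` Omega) y -> (- M <= sup_ball u x)%R}.
    move: uM (sup_ball_ae uM Ox); apply: filterS2 => y uM us yx.
    by apply: le_trans (us yx); have := uM yx.2; rewrite ler_norml => /andP[].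
  by have [] := ae_exists (mball x) (eball_Omega_gt0 Ox) H.
apply/(sup_ball_le _ uM Ox); move: uM; apply: filterS => y uM [_ Oy].
by rewrite (le_trans (ler_norm _))// uM.
Qed.

(** [sup_ball u x > a] holds exactly when the points [y] of the ball with [u y > a] have positive
    measure, and the measure of a section depends measurably on [x]. *)
Lemma measurable_sup_ball u M : measurable_fun Omega u -> ess_bounded Omega u M ->
  measurable_fun Omega (sup_ball u).
Proof.
move=> mu uM; apply: (measurability _ (RGenOInfty.measurableE R)).
move=> _ [_ [a ->] <-].
pose A := Omega2 `&` near_diag eps `&` (fun z => u z.2) @^-1` `]a, +oo[.
have mA : measurable A.
  rewrite /A setIAC; apply: measurableI; last exact: measurable_near_diag.
  exact: (measurable_snd_setX mO mu mO2 (measurable_itv `]a, +oo[)).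
rewrite (_ : _ `&` _ = Omega `&` (lam \o xsection A) @^-1` `]0, +oo]).
  have := measurable_fun_xsection lam mA.
  move=> /(measurable_funTS (D := Omega)); apply => //.
  exact: emeasurable_itv.
apply/seteqP; split => x [Ox] /=; rewrite !in_itv /= ?andbT ?leey ?andbT => sx.
- split => //; rewrite lt_neqAle measure_ge0 andbT eq_sym; apply/eqP => A0.
  move: sx; rewrite ltNge => /negP; apply; apply/(sup_ball_le _ uM Ox).
  exists (xsection A x); split => //; first exact: measurable_xsection.
  move=> y /= /not_implyP [[xy Oy] /negP]; rewrite -ltNge => auy.
  by rewrite /xsection /= inE; split => //; rewrite /= in_itv /= andbT.
- split => //; rewrite ltNge; apply/negP => /(sup_ball_le _ uM Ox)[B [mB B0 uB]].
  move: sx; rewrite (subset_measure0 _ mB _ B0) ?ltxx//.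
    exact: measurable_xsection.
  move=> y; rewrite /xsection /= inE => -[[[_ Oy] xy]] /=; rewrite in_itv/= andbT.
  by move=> auy; apply: uB => /= /(_ (conj xy Oy)); rewrite leNgt auy.
Qed.

End essential_supremum_ball.

(** * Nonlocal total variation *)

Section total_variation.
Variables (R : realType) (N : nat) (eps : R) (Omega : set 'rV[R]_N).
Local Notation E := 'rV[R]_N.
Local Notation lam := (lebesgue_rV R N).
Local Notation lam2 := (lam \x lam).
Local Notation Omega2 := (Omega `*` Omega).
Local Notation sup_ball := (@sup_ball R N eps Omega).
Hypotheses (N0 : (0 < N)%N) (eps0 : (0 < eps)%R) (oO : open Omega).
Hypothesis (bO : bounded_set Omega).
Implicit Types (u : E -> R) (rho : E -> R) (K Psi : E * E -> R).
Let mO : measurable Omega. Proof. exact: open_measurable_rV. Qed.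
Let mO2 : measurable Omega2. Proof. exact: measurableX. Qed.

(** The pairing of one weighted kernel with the gradient of [u]. Its bound [slope] is the first half
    of [TV_eps]; taken at [- u], it is the second. *)
Definition gain Psi rho u : \bar R :=
  \int[lam2]_(z in Omega2) (weight Psi rho z * grad_eps eps u z)%:E.

Definition slope rho u : \bar R :=
  \int[lam]_(x in Omega) ((sup_ball u x - u x) / eps * rho x)%:E.

Lemma weightE Psi K rho : {ae lam2, forall z, Omega2 z -> Psi z = K z} ->
  ae_eq lam2 Omega2 (EFin \o weight K rho) (EFin \o weight Psi rho).
Proof. by apply: filterS => z PK Oz; rewrite /= /weight PK. Qed.

Lemma measurable_weight Psi rho : measurable_fun Omega2 Psi ->
  lam.-integrable Omega (EFin \o rho) -> measurable_fun Omega2 (weight Psi rho).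
Proof.
move=> mPsi irho; apply: measurable_funM => //; apply: measurable_fst_setX => //.
by apply/measurable_EFinP; exact: measurable_int irho.
Qed.

Lemma integrable_weight Psi rho : admissible Omega eps Psi ->
  lam.-integrable Omega (EFin \o rho) ->
  lam2.-integrable Omega2 (EFin \o weight Psi rho).
Proof.
move=> aPsi irho; have [K [kK _] PK] := admissible_kernel mO N0 aPsi.
apply: ae_eq_integrable (weightE rho PK)
  (integrable_transition_density mO kK irho) => //.
apply/measurable_EFinP; apply: measurable_weight => //.
by case: aPsi => /measurable_int/measurable_EFinP.
Qed.

Lemma weight_near_diag Psi rho : admissible Omega eps Psi ->
  {ae lam2, forall z, Omega2 z -> ~ near_diag eps z -> weight Psi rho z = 0%R}.
Proof.
move=> aPsi; have [K [_ lK] PK] := admissible_kernel mO N0 aPsi.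
by move: PK; apply: filterS => z PK Oz nz; rewrite /weight PK// lK// mul0r.
Qed.

Lemma integrable_slope rho u M : lam.-integrable Omega (EFin \o rho) ->
  measurable_fun Omega u -> ess_bounded Omega u M ->
  lam.-integrable Omega (fun x => ((sup_ball u x - u x) / eps * rho x)%:E).
Proof.
move=> irho mu uM.
have ms := measurable_sup_ball eps0 oO mu uM.
have /(eq_integrable mO) : lam.-integrable Omega
    (fun x => (rho x * ((sup_ball u x - u x) / eps))%:E).
  apply: (@integrableM_ae_bounded _ _ _ _ _ mO _ _ ((M + M) / eps)%R) => //.
    by apply: measurable_funM => //; exact: measurable_funB.
  have uM' := uM; move: uM; apply: filterS => x uM Ox.
  rewrite normrM (gtr0_norm (_ : 0 < eps^-1)%R) ?invr_gt0//.
  rewrite ler_pM2r ?invr_gt0// (le_trans (ler_normB _ _))// lerD ?uM//.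
  exact: sup_ball_bounded uM' _.
by apply => x _; rewrite mulrC.
Qed.

Lemma gain_le_slope Psi rho u : admissible Omega eps Psi ->
  lam.-integrable Omega (EFin \o rho) ->
  {ae lam, forall x, Omega x -> (0 <= rho x)%R} ->
  Linfty lam Omega u -> gain Psi rho u <= slope rho u.
Proof.
move=> aPsi irho rho0 /Linfty_ess_bounded[mu [M uM]].
have [K [kK lK] PK] := admissible_kernel mO N0 aPsi.
have islope := integrable_slope irho mu uM.
rewrite /slope -(integral_transition_density mO kK islope).
apply: ae_le_integral => //.
- exact: (integrable_mul_grad eps mO (integrable_weight aPsi irho) mu uM).
- exact: (integrable_transition_density mO kK islope).
have ms := measurable_sup_ball eps0 oO mu uM.
(* The nearby pairs violating [u y <= sup_ball u x]. *)
pose A := near_diag eps `&` (Omega2 `&`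
  (fun z => u z.2 - sup_ball u z.1)%R @^-1` `]0%R, +oo[).
have mA : measurable A.
  apply: measurableI; first exact: measurable_near_diag.
  have : measurable_fun Omega2 (fun z : E * E => u z.2 - sup_ball u z.1)%R.
    apply: measurable_funB; first exact: measurable_snd_setX.
    exact: measurable_fst_setX.
  by apply => //; exact: measurable_itv.
have A0 x : {ae lam, forall y, ~ A (x, y)}.
  have [Ox|nOx] := pselect (Omega x); last by apply: nearW => y [_ [[]]].
  have := sup_ball_ae eps0 oO uM Ox; apply: filterS => y us [xy [[_ Oy]]] /=.
  by rewrite in_itv /= andbT subr_gt0 ltNge us.
have := ae_of_section lam mA A0; have := ae_fst lam rho0.
move: PK; apply: filterS3 => z PK rho0z nA Oz.
rewrite /weight PK// lee_fin.
have [nz|nz] := pselect (near_diag eps z); last by rewrite lK// !mul0r.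
rewrite -mulrA ler_wpM2l//; first by have [_ ->] := kK.
rewrite mulrC ler_wpM2r//; first by apply: rho0z; case: Oz.
rewrite /grad_eps ler_pM2r ?invr_gt0// lerD2r leNgt; apply/negP => us.
by apply: nA; split => //; split => //=; rewrite in_itv /= andbT subr_gt0.
Qed.

Lemma gain_approx rho u (e : R) : (0 < e)%R ->
  lam.-integrable Omega (EFin \o rho) ->
  {ae lam, forall x, Omega x -> (0 <= rho x)%R} ->
  Linfty lam Omega u ->
  exists2 Psi, admissible Omega eps Psi & slope rho u <= gain Psi rho u + e%:E.
Proof.
move=> e0 irho rho0 /Linfty_ess_bounded[mu [M uM]].
have ms := measurable_sup_ball eps0 oO mu uM.
have rho_ge0 : 0 <= \int[lam]_(x in Omega) (rho x)%:E.
  by rewrite -(integral0 lam Omega); apply: ae_le_integral => //; exact: integrable0.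
have rho_fin := integrable_fin_num mO irho.
(* The total loss will be [delta] times the mass of [rho], thus at most [e]; the 1 keeps the
   denominator positive. *)
pose delta := (e / (1 + fine (\int[lam]_(x in Omega) (rho x)%:E)))%R.
have delta0 : (0 < delta)%R.
  by rewrite divr_gt0// ltr_pwDl// fine_ge0.
(* [grad_eps] divides by [eps], so missing the supremum by less than [c] costs less than [delta]. *)
pose c := (delta * eps)%R.
have c0 : (0 < c)%R by rewrite mulr_gt0.
pose A := near_diag eps `&` (Omega2 `&`
  (fun z => u z.2 - sup_ball u z.1)%R @^-1` `](- c)%R, +oo[).
have mA : measurable A.
  apply: measurableI; first exact: measurable_near_diag.
  have : measurable_fun Omega2 (fun z : E * E => u z.2 - sup_ball u z.1)%R.
    apply: measurable_funB; first exact: measurable_snd_setX.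
    exact: measurable_fst_setX.
  by apply => //; exact: measurable_itv.
have lamO : lam Omega < +oo by exact: lebesgue_rV_bounded.
have mAx x : measurable (xsection A x) by exact: measurable_xsection.
have AxO x : xsection A x `<=` Omega.
  by move=> y; rewrite /xsection /= inE => -[_ [[]]].
have Ax_fin x : lam (xsection A x) \is a fin_num.
  rewrite ge0_fin_numE// (le_lt_trans _ lamO)//.
  by apply: le_measure; rewrite ?inE.
(* A null section would make [sup_ball u x - c] an essential upper bound, smaller than the least
   one. *)
have Ax_gt0 x : Omega x -> 0 < lam (xsection A x).
  move=> Ox; rewrite lt_neqAle measure_ge0 andbT eq_sym; apply/eqP => Ax0.
  have : (sup_ball u x <= sup_ball u x - c)%R.
    apply/(sup_ball_le eps0 oO _ uM Ox).
    exists (xsection A x); split => // y /= /not_implyP[[xy Oy] /negP].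
    rewrite -ltNge => uy; rewrite /xsection /= inE; split => //; split => //=.
    by rewrite in_itv /= andbT ltrBrDl.
  by rewrite leNgt ltrBlDr ltrDl c0.
pose P x := fine (lam (xsection A x)).
have P_gt0 x : Omega x -> (0 < P x)%R.
  by move=> Ox; rewrite fine_gt0// Ax_gt0//= ltey_eq Ax_fin.
(* [`^ (-1)] stands for the inverse because its measurability is known. *)
pose K z := (\1_A z * P z.1 `^ (-1))%R.
have mP : measurable_fun setT P.
  apply: (measurableT_comp (fine_measurable measurableT)).
  exact: measurable_fun_xsection.
have mK : measurable_fun setT K.
  apply: measurable_funM; first exact: measurable_indic.
  apply: (measurableT_comp (measurable_powR (-1)%R)).
  exact: (measurableT_comp mP measurable_fst).
have K0 z : (0 <= K z)%R by rewrite mulr_ge0 ?powR_ge0// indicE.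
have KA z : ~ A z -> K z = 0%R by move=> nA; rewrite /K indicE memNset// mul0r.
have K1 x : Omega x -> \int[lam]_(y in Omega) (K (x, y))%:E = 1.
  move=> Ox; under eq_integral.
    move=> y _; rewrite /K /= EFinM.
    rewrite (_ : \1_A (x, y) = \1_(xsection A x) y :> R); last first.
      by rewrite !indicE mem_xsection.
    over.
  rewrite /= ge0_integralZr//.
  - rewrite integral_indic// setIidl; last exact: AxO.
    rewrite powR_inv1; last exact/ltW/P_gt0.
    rewrite [X in X * _](_ : _ = (P x)%:E); last by rewrite /P fineK.
    by rewrite -EFinM divff// gt_eqF// P_gt0.
  - by apply/measurable_EFinP; exact: measurable_indic.
  - by rewrite lee_fin powR_ge0.
have kK : transition_density Omega K.
  by split => //; [exact: measurable_funTS|apply: nearW => x; exact: K1].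
have iK : lam2.-integrable Omega2 (EFin \o K).
  have i1 : lam.-integrable Omega (EFin \o cst 1%R).
    apply: measurable_bounded_integrable => //.
    by exists 1%R; split => // r r1 x _ /=; rewrite normr1 ltW.
  have := integrable_transition_density mO kK i1.
  by apply: eq_integrable => // z _; rewrite /= mulr1.
have aK : admissible Omega eps K.
  split => //; first exact: nearW.
  exists K; split => //; [by case: kK|exact: nearW|].
  move=> x Ox; split; first exact: K1.
  (* A point outside either closure lies in its open complement, on which [K (x, .)] vanishes or
     which misses [Omega]. *)
  move=> y; apply: contraPP => /not_andP ny /=; apply.
  case: ny => ny.
    exists (~` closure (eball x eps)) => //.
    split; first exact/closed_openC/closed_closure.
    apply: nearW => z [_ nz]; apply: KA => -[xz _]; apply: nz.
    exact: subset_closure.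
  exists (~` closure Omega) => //; split; first exact/closed_openC/closed_closure.
  by apply: nearW => z [Oz nz]; exfalso; apply: nz; exact: subset_closure.
exists K => //.
have islope := integrable_slope irho mu uM.
(* A lower bound for the integrand of [gain] on [A] that depends on [x] alone, so its integral
   against [K] is just that of [g]. *)
pose g x := ((sup_ball u x - u x) / eps * rho x - delta * rho x)%R.
have idrho : lam.-integrable Omega (fun x => (delta * rho x)%:E).
  have := integrableZl mO delta irho.
  by apply: eq_integrable => // x _; rewrite EFinM.
have ig : lam.-integrable Omega (EFin \o g).
  have := integrableB mO islope idrho.
  by apply: eq_integrable.
have : \int[lam]_(x in Omega) (g x)%:E <= gain K rho u.
  rewrite -(integral_transition_density mO kK ig); apply: ae_le_integral => //.
  - exact: (integrable_transition_density mO kK ig).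
  - exact: (integrable_mul_grad eps mO (integrable_weight aK irho) mu uM).
  have := ae_fst lam rho0; apply: filterS => z /= rho0z Oz.
  have [Az|nAz] := pselect (A z); last by rewrite /weight KA// !mul0r.
  rewrite lee_fin /weight -mulrA ler_wpM2l// /g -mulrBl mulrC ler_wpM2l//.
    by apply: rho0z; case: Oz.
  rewrite /grad_eps ler_pdivlMr// mulrBl divfK ?gt_eqF//.
  have [_ [_]] := Az; rewrite /= in_itv /= andbT ltrBrDl => /ltW uz.
  by rewrite addrAC lerD2r.
rewrite (_ : \int[lam]_(x in Omega) (g x)%:E =
    slope rho u - (delta%:E * \int[lam]_(x in Omega) (rho x)%:E)); last first.
  rewrite -integralZl// -integralB//.
rewrite leeBlDr ?fin_numM// => /le_trans; apply; apply: leeD2l.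
rewrite -[X in _ * X]fineK// -EFinM lee_fin.
rewrite /delta mulrAC ler_pdivrMr ?ltr_pwDl ?fine_ge0//.
by rewrite ler_pM2l// lerDr.
Qed.

Lemma Linfty_opp u : Linfty lam Omega u -> Linfty lam Omega (\- u)%R.
Proof.
move=> [mu ub]; split; first exact: measurable_funN.
by under [X in ess_sup_on _ _ X]funext => x do rewrite normrN.
Qed.

Lemma ess_inf_on_opp D u : measurable D ->
  ess_inf_on lam D u = - ess_sup_on lam D (\- u)%R.
Proof. by move=> mD; rewrite (ess_inf_onE _ mD) (ess_sup_onE _ mD) ess_infEN. Qed.

Lemma TV_epsE (rho : bool -> E -> R) u : Linfty lam Omega u ->
  TV_eps Omega eps rho u = slope (rho false) u + slope (rho true) (\- u)%R.
Proof.
move=> Lu; have [_ [M uM]] := Linfty_ess_bounded Lu.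
have [_ [M' uM']] := Linfty_ess_bounded (Linfty_opp Lu).
congr (_ + _); apply: eq_integral => x /[!inE] Ox.
  by rewrite (sup_ballE eps0 oO uM Ox) -EFinB -!EFinM.
rewrite ess_inf_on_opp; last first.
  by apply: measurableI => //; exact: measurable_eball.
rewrite (sup_ballE eps0 oO uM' Ox) oppeK -EFinD -!EFinM.
by congr (_ / _ * _)%:E; rewrite opprK addrC.
Qed.

Lemma integral_div_eps_weight Psi rho u : admissible Omega eps Psi ->
  lam.-integrable Omega (EFin \o rho) -> Linfty lam Omega u ->
  - (\int[lam]_(y in Omega) ((u y)%:E * div_eps Omega eps (weight Psi rho) y)) =
  gain Psi rho u.
Proof.
move=> aPsi irho /Linfty_ess_bounded[mu [M uM]].
by rewrite (integral_div_eps mO (integrable_weight aPsi irho)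
  (weight_near_diag rho aPsi) mu uM) oppeK.
Qed.

(** The minus sign in [weight2] is absorbed by the gradient, turning [u] into [- u] in the second
    term and decoupling the two kernels. *)
Lemma integral_div_eps_weight2 (Psi : bool -> E * E -> R) (rho : bool -> E -> R) u :
  (forall i, admissible Omega eps (Psi i)) ->
  (forall i, lam.-integrable Omega (EFin \o rho i)) -> Linfty lam Omega u ->
  - (\int[lam]_(y in Omega) ((u y)%:E * div_eps Omega eps (weight2 Psi rho) y)) =
  gain (Psi false) (rho false) u + gain (Psi true) (rho true) (\- u)%R.
Proof.
move=> aPsi irho Lu; have [mu [M uM]] := Linfty_ess_bounded Lu.
have [mu' [M' uM']] := Linfty_ess_bounded (Linfty_opp Lu).
have iW i := integrable_weight (aPsi i) (irho i).
have iW2 : lam2.-integrable Omega2 (EFin \o weight2 Psi rho).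
  by have := integrableB mO2 (iW false) (iW true); apply: eq_integrable.
rewrite (integral_div_eps mO iW2 _ mu uM); last first.
  have := weight_near_diag (rho true) (aPsi true).
  move: (weight_near_diag (rho false) (aPsi false)).
  apply: filterS2 => z W0 W1 Oz nz.
  by rewrite /weight2 W0// W1// subr0.
rewrite oppeK /gain -integralD//; last 2 first.
- exact: (integrable_mul_grad eps mO (iW false) mu uM).
- exact: (integrable_mul_grad eps mO (iW true) mu' uM').
apply: eq_integral => z _; rewrite -EFinD; congr EFin.
rewrite /weight2 mulrBl; congr (_ + _)%R.
by rewrite -mulrN /grad_eps -mulNr opprB opprK addrC.
Qed.

End total_variation.

Theorem proposition3p19 (R : realType) (N : nat) (eps : R)
    (Omega : set 'rV[R]_N) (mu : probability ('rV[R]_N * bool)%type R)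
    (rho : bool -> 'rV[R]_N -> R) :
  (0 < N)%N ->
  (0 < eps)%R ->
  is_domain Omega ->
  bounded_set Omega ->
  convex_set Omega ->
  mu (Omega `*` [set: bool]) = 1 ->
  (forall i, marginal mu i `<< lebesgue_rV R N) ->
  (forall i, is_density Omega (marginal mu i) (rho i)) ->
  (forall (u : 'rV[R]_N -> R) (Psi : 'rV[R]_N * 'rV[R]_N -> R) (i : bool),
     Linfty (lebesgue_rV R N) Omega u -> admissible Omega eps Psi ->
     \int[lebesgue_rV R N]_(x in Omega) \int[lebesgue_rV R N]_(y in Omega)
        (Psi (x, y) * rho i x * grad_eps eps u (x, y))%:E =
     - \int[lebesgue_rV R N]_(y in Omega)
        ((u y)%:E * div_eps Omega eps (weight Psi (rho i)) y)) /\
  (forall u : 'rV[R]_N -> R, Linfty (lebesgue_rV R N) Omega u ->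
     TV_eps Omega eps rho u =
     ereal_sup [set - \int[lebesgue_rV R N]_(y in Omega)
                     ((u y)%:E * div_eps Omega eps (weight2 Psi rho) y)
               | Psi in [set Psi : bool -> 'rV[R]_N * 'rV[R]_N -> R |
                          forall i, admissible Omega eps (Psi i)]]).
Proof.
move=> N0 eps0 [_ oO _] bO _ mu1 _ rho_dens.
have mO : measurable Omega by exact: open_measurable_rV.
have irho i : (lebesgue_rV R N).-integrable Omega (EFin \o rho i) := (rho_dens i).1.
(* [is_density] says nothing about the sign, which comes from the marginals being nonnegative. *)
have rho0 i : {ae lebesgue_rV R N, forall x, Omega x -> (0 <= rho i x)%R}.
  apply: (integrable_ge0_ae mO (irho i)) => A mA AO.
  by rewrite -(rho_dens i).2// /marginal measure_ge0.
split=> [u Psi i Lu aPsi|u Lu].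
  rewrite (integral_div_eps_weight N0 oO aPsi (irho i) Lu).
  have [mu' [M uM]] := Linfty_ess_bounded Lu.
  exact: (integral12_setX mO mO (integrable_mul_grad eps mO
    (integrable_weight N0 oO aPsi (irho i)) mu' uM)).
have Lu' := Linfty_opp Lu.
rewrite (TV_epsE eps0 oO rho Lu); apply/eqP; rewrite eq_le; apply/andP; split.
  (* The two kernels of a pair are chosen independently, each within [e / 2] of its slope. *)
  apply/lee_addgt0Pr => e e0; have e20 : (0 < e / 2)%R by rewrite divr_gt0.
  have [Psi0 aPsi0 le0] :=
    gain_approx N0 eps0 oO bO e20 (irho false) (rho0 false) Lu.
  have [Psi1 aPsi1 le1] :=
    gain_approx N0 eps0 oO bO e20 (irho true) (rho0 true) Lu'.
  pose Psi i := if i then Psi1 else Psi0.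
  have aPsi i : admissible Omega eps (Psi i) by case: i.
  apply: le_trans (leeD le0 le1) _; rewrite addeACA -EFinD -splitr leeD2r//.
  apply: ereal_sup_ubound; exists Psi => //.
  exact: (integral_div_eps_weight2 N0 oO aPsi irho Lu).
apply: ge_ereal_sup => _ [Psi aPsi <-].
rewrite (integral_div_eps_weight2 N0 oO aPsi irho Lu).
by apply: leeD; exact: gain_le_slope.
Qed.
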